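(* Let $\mathcal{G}=(\mathcal{C},\mathcal{E})$ be a finite simple graph and let $(G_c)_{c\in\mathcal{C}}$ be countable sofic groups. Then the graph product of the groups $(G_c)_{c\in\mathcal{C}}$ over $\mathcal{G}$ is sofic.
   Context: A simple graph $(\mathcal{C},\mathcal{E})$ has a finite vertex set and a symmetric, irreflexive edge relation $\mathcal{E}\subset\mathcal{C}\times\mathcal{C}$. The graph product of $(G_c)_{c\in\mathcal{C}}$ over $\mathcal{G}$ is the quotient of the free product of the groups $G_c$, $c\in\mathcal{C}$, by the normal subgroup generated by all commutators $[g,h]$ with $g\in G_c$, $h\in G_{c'}$ and $(c,c')\in\mathcal{E}$. For $\sigma,\tau$ in the symmetric group $S_N$, let $d_{\mathrm{Hamm}}(\sigma,\tau)=\frac1N\#\{j:\sigma(j)\neq\tau(j)\}$. A countable group $\Gamma$ is sofic if there exist natural numbers $N_k\to\infty$ and maps $\sigma_k:\Gamma\to S_{N_k}$ (not necessarily homomorphisms) such that $\lim_{k\to\infty}d_{\mathrm{Hamm}}(\sigma_k(g)\sigma_k(h),\sigma_k(gh))=0$ for all $g,h\in\Gamma$, and for every $g\in\Gamma$, $\lim_{k\to\infty}d_{\mathrm{Hamm}}(\sigma_k(g),\mathrm{id})$ equals $0$ if $g=e$ and $1$ if $g\ne e$. *)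

(* Defs.v *)
From HB Require Import structures.
From mathcomp Require Import all_boot all_order all_algebra perm.
From mathcomp Require Import all_classical all_reals all_analysis.

Set Implicit Arguments.
Unset Strict Implicit.
Unset Printing Implicit Defensive.

Import Order.TTheory GRing.Theory Num.Theory.
Import numFieldNormedType.Exports.

Local Open Scope classical_set_scope.
Local Open Scope group_scope.
Local Open Scope quotient_scope.

(* Groups are the possibly infinite [groupType]s of boot/monoid.v.            *)

Section NormalSubgroups.
Variable X : groupType.

Definition is_normal_subgroup (N : set X) : Prop :=
  [/\ N 1, forall x y : X, N x -> N y -> N (x * y^-1)
    & forall x y : X, N x -> N (x ^ y)].

Record normal_subgroup := NormalSubgroup {
  normal_set :> set X;
  normal_setP : is_normal_subgroup normal_set }.

Lemma smallest_is_normal_subgroup (S : set X) :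
  is_normal_subgroup (smallest is_normal_subgroup S).
Proof.
split=> [N [[]] // |x y Nx Ny N sN|x y Nx N sN]; have [[_ ND NJ] _] := sN.
  by apply: ND; [apply: Nx | apply: Ny].
by apply: NJ; apply: Nx.
Qed.

Definition normal_closure (S : set X) : normal_subgroup :=
  NormalSubgroup (smallest_is_normal_subgroup S).

End NormalSubgroups.

Section QuotientGroup.
Variables (X : groupType) (N : normal_subgroup X).
Implicit Types x y : X.

Definition coset_eq : rel X := fun x y => `[< (N : set X) (x^-1 * y) >].

Let N1 : (N : set X) 1. Proof. by case: (normal_setP N). Qed.
Let NV x : (N : set X) x -> (N : set X) x^-1.
Proof. by case: (normal_setP N) => _ ND _ Nx; rewrite -(mul1g x^-1); apply: ND. Qed.
Let NM x y : (N : set X) x -> (N : set X) y -> (N : set X) (x * y).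
Proof.
case: (normal_setP N) => _ ND _ Nx Ny.
by rewrite -(invgK y); apply: ND => //; apply: NV.
Qed.
Let NJ x y : (N : set X) x -> (N : set X) (x ^ y).
Proof. by case: (normal_setP N) => _ _; apply. Qed.

Lemma coset_eq_refl : reflexive coset_eq.
Proof. by move=> x; apply/asboolP; rewrite mulVg. Qed.

Lemma coset_eq_sym : symmetric coset_eq.
Proof. by move=> x y; apply/asboolP/asboolP => /NV; rewrite invgM invgK. Qed.

Lemma coset_eq_trans : transitive coset_eq.
Proof.
move=> y x z /asboolP xy /asboolP yz; apply/asboolP.
by move: (NM xy yz); rewrite -mulgA mulVKg.
Qed.

Canonical coset_eq_equiv :=
  EquivRel coset_eq coset_eq_refl coset_eq_sym coset_eq_trans.

Definition quotient_group : Type := {eq_quot coset_eq}.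
HB.instance Definition _ := EqQuotient.on quotient_group.
HB.instance Definition _ := Choice.on quotient_group.

Definition quotient_mul := lift_op2 quotient_group (fun x y : X => x * y).
Definition quotient_inv := lift_op1 quotient_group (fun x : X => x^-1).
Definition quotient_one : quotient_group := \pi_quotient_group 1.

Lemma coset_repr x : (N : set X) (x^-1 * repr (\pi_quotient_group x)).
Proof.
have /eqmodP/asboolP : x = repr (\pi_quotient_group x) %[mod quotient_group].
  by rewrite reprK.
exact.
Qed.

Lemma pi_quotient_mul :
  {morph \pi_quotient_group : x y / x * y >-> quotient_mul x y}.
Proof.
unlock quotient_mul => x y; apply/eqmodP/asboolP => /=.
set x' := repr _; set y' := repr _.
have xx' : (N : set X) (x^-1 * x') by apply: coset_repr.
have yy' : (N : set X) (y^-1 * y') by apply: coset_repr.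
have -> : (x * y)^-1 * (x' * y') = (x^-1 * x') ^ y * (y^-1 * y').
  by rewrite /conjg invgM !mulgA mulgK.
by apply: NM => //; apply: NJ.
Qed.

Lemma pi_quotient_inv :
  {morph \pi_quotient_group : x / x^-1 >-> quotient_inv x}.
Proof.
unlock quotient_inv => x; apply/eqmodP/asboolP => /=.
set x' := repr _.
have xx' : (N : set X) (x^-1 * x') by apply: coset_repr.
have -> : x^-1^-1 * x'^-1 = ((x^-1 * x')^-1) ^ x^-1.
  by rewrite /conjg invgM !invgK -!mulgA mulgV mulg1.
by apply: NJ; apply: NV.
Qed.

Canonical pi_quotient_mul_morph := PiMorph2 pi_quotient_mul.
Canonical pi_quotient_inv_morph := PiMorph1 pi_quotient_inv.

Lemma quotient_mulA : associative quotient_mul.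
Proof. by elim/quotW=> x; elim/quotW=> y; elim/quotW=> z; rewrite !piE mulgA. Qed.

Lemma quotient_mul1 : left_id quotient_one quotient_mul.
Proof. by elim/quotW=> x; rewrite /quotient_one !piE mul1g. Qed.

Lemma quotient_mulr1 : right_id quotient_one quotient_mul.
Proof. by elim/quotW=> x; rewrite /quotient_one !piE mulg1. Qed.

Lemma quotient_mulV : left_inverse quotient_one quotient_inv quotient_mul.
Proof. by elim/quotW=> x; rewrite /quotient_one !piE mulVg. Qed.

Lemma quotient_mulrV : right_inverse quotient_one quotient_inv quotient_mul.
Proof. by elim/quotW=> x; rewrite /quotient_one !piE mulgV. Qed.

HB.instance Definition _ := isGroup.Build quotient_group
  quotient_mulA quotient_mul1 quotient_mulr1 quotient_mulV quotient_mulrV.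

End QuotientGroup.

Section FreeProduct.
Variables (I : choiceType) (G : I -> groupType).

Definition fp_letter (i : I) (x : G i) : {i : I & G i} := Tagged G x.

Inductive fp_rel : seq {i : I & G i} -> seq {i : I & G i} -> Prop :=
| fp_rel_one u v i : fp_rel (u ++ fp_letter (1 : G i) :: v) (u ++ v)
| fp_rel_mul u v i (x y : G i) :
    fp_rel (u ++ [:: fp_letter x, fp_letter y & v]) (u ++ fp_letter (x * y) :: v)
| fp_rel_refl u : fp_rel u u
| fp_rel_sym u v : fp_rel u v -> fp_rel v u
| fp_rel_trans u v w : fp_rel u v -> fp_rel v w -> fp_rel u w.

Definition fp_eq : rel (seq {i : I & G i}) := fun u v => `[< fp_rel u v >].

Lemma fp_eq_refl : reflexive fp_eq.
Proof. by move=> u; apply/asboolP; apply: fp_rel_refl. Qed.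

Lemma fp_eq_sym : symmetric fp_eq.
Proof. by move=> u v; apply/asboolP/asboolP; apply: fp_rel_sym. Qed.

Lemma fp_eq_trans : transitive fp_eq.
Proof.
move=> v u w /asboolP uv /asboolP vw; apply/asboolP.
exact: fp_rel_trans uv vw.
Qed.

Canonical fp_eq_equiv := EquivRel fp_eq fp_eq_refl fp_eq_sym fp_eq_trans.

Definition free_product : Type := {eq_quot fp_eq}.
HB.instance Definition _ := EqQuotient.on free_product.
HB.instance Definition _ := Choice.on free_product.

Definition fp_word_inv (u : seq {i : I & G i}) : seq {i : I & G i} :=
  rev [seq let: existT i x := a in fp_letter x^-1 | a <- u].

Lemma fp_rel_cat u u' v v' :
  fp_rel u u' -> fp_rel v v' -> fp_rel (u ++ v) (u' ++ v').
Proof.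
move=> ruu' rvv'; apply: (@fp_rel_trans _ (u' ++ v)).
  elim: ruu' => [s w i|s w i x y|s|s w _|s w z _ sw _ wz].
  - by rewrite -!catA; apply: fp_rel_one.
  - by rewrite -!catA; apply: fp_rel_mul.
  - exact: fp_rel_refl.
  - exact: fp_rel_sym.
  - exact: fp_rel_trans sw wz.
elim: rvv' => [s w i|s w i x y|s|s w _|s w z _ sw _ wz].
- by rewrite !catA; apply: fp_rel_one.
- by rewrite !catA; apply: fp_rel_mul.
- exact: fp_rel_refl.
- exact: fp_rel_sym.
- exact: fp_rel_trans sw wz.
Qed.

Lemma fp_rel_inv u v : fp_rel u v -> fp_rel (fp_word_inv u) (fp_word_inv v).
Proof.
rewrite /fp_word_inv; elim=> {u v} [u w i|u w i x y|u|u w _|u w z _ uw _ wz].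
- rewrite !map_cat /= !rev_cat rev_cons cat_rcons /= invg1.
  exact: fp_rel_one.
- rewrite !map_cat /= !rev_cat !rev_cons !cat_rcons /= invgM.
  exact: fp_rel_mul.
- exact: fp_rel_refl.
- exact: fp_rel_sym.
- exact: fp_rel_trans uw wz.
Qed.

Definition fp_mul := lift_op2 free_product (@cat {i : I & G i}).
Definition fp_inv := lift_op1 free_product fp_word_inv.
Definition fp_one : free_product := \pi_free_product [::].

Lemma fp_rel_repr u : fp_rel u (repr (\pi_free_product u)).
Proof.
have /eqmodP/asboolP : u = repr (\pi_free_product u) %[mod free_product].
  by rewrite reprK.
exact.
Qed.

Lemma pi_fp_mul : {morph \pi_free_product : u v / u ++ v >-> fp_mul u v}.
Proof.
unlock fp_mul => u v; apply/eqmodP/asboolP.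
by apply: fp_rel_cat; apply: fp_rel_repr.
Qed.

Lemma pi_fp_inv : {morph \pi_free_product : u / fp_word_inv u >-> fp_inv u}.
Proof.
unlock fp_inv => u; apply/eqmodP/asboolP.
by apply: fp_rel_inv; apply: fp_rel_repr.
Qed.

Canonical pi_fp_mul_morph := PiMorph2 pi_fp_mul.
Canonical pi_fp_inv_morph := PiMorph1 pi_fp_inv.

Lemma fp_mulA : associative fp_mul.
Proof. by elim/quotW=> x; elim/quotW=> y; elim/quotW=> z; rewrite !piE catA. Qed.

Lemma fp_mul1 : left_id fp_one fp_mul.
Proof. by elim/quotW=> x; rewrite /fp_one !piE. Qed.

Lemma fp_mulr1 : right_id fp_one fp_mul.
Proof. by elim/quotW=> x; rewrite /fp_one !piE cats0. Qed.

Lemma fp_rel_mulV u : fp_rel (fp_word_inv u ++ u) [::].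
Proof.
elim: u => [|[i x] u IHu]; first exact: fp_rel_refl.
rewrite /fp_word_inv /= rev_cons cat_rcons -/(fp_word_inv u).
apply: fp_rel_trans (fp_rel_mul _ _ _ _) _; rewrite /= mulVg.
exact: fp_rel_trans (fp_rel_one _ _ _) IHu.
Qed.

Lemma fp_word_invK : involutive fp_word_inv.
Proof.
move=> u; rewrite /fp_word_inv map_rev revK -map_comp.
by rewrite -[RHS]map_id; apply: eq_map => -[i x]; rewrite /= invgK.
Qed.

Lemma fp_mulV : left_inverse fp_one fp_inv fp_mul.
Proof.
elim/quotW=> u; rewrite /fp_one !piE; apply/eqmodP/asboolP.
exact: fp_rel_mulV.
Qed.

Lemma fp_mulrV : right_inverse fp_one fp_inv fp_mul.
Proof.
elim/quotW=> u; rewrite /fp_one !piE; apply/eqmodP/asboolP.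
by rewrite -{1}(fp_word_invK u); apply: fp_rel_mulV.
Qed.

HB.instance Definition _ :=
  isGroup.Build free_product fp_mulA fp_mul1 fp_mulr1 fp_mulV fp_mulrV.

Definition fp_in (i : I) (x : G i) : free_product :=
  \pi_free_product [:: fp_letter x].

End FreeProduct.

Section GraphProduct.
Variables (C : choiceType) (E : rel C) (G : C -> groupType).

Definition graph_commutators : set (free_product G) :=
  [set z | exists c c' (g : G c) (h : G c'), E c c' /\ z = [~ fp_in g, fp_in h]].

Definition graph_product : groupType :=
  quotient_group (normal_closure graph_commutators).

End GraphProduct.

Section Sofic.
Variable R : realType.

Definition dHamm (N : nat) (s t : 'S_N) : R :=
  (#|[set j | s j != t j]%SET|%:R / N%:R)%R.

(* Products in 'S_N act from left to right ([permM]: (s * t) j = t (s j)), so *)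
(* [sigma k h * sigma k g] is the composition of maps usually written         *)
(* sigma_k(g) sigma_k(h).                                                     *)
Definition sofic (X : groupType) : Prop :=
  countable [set: X] /\
  exists (N : nat -> nat) (sigma : forall k : nat, X -> 'S_(N k)),
    [/\ N @ \oo --> \oo,
        forall g h : X,
          dHamm (sigma k h * sigma k g) (sigma k (g * h)) @[k --> \oo]
            --> (0 : R)%R
      & forall g : X,
          dHamm (sigma k g) 1 @[k --> \oo]
            --> (if g == 1%g then 0 else 1 : R)%R].

End Sofic.

(* Main.v *)
Require Import Defs.
From mathcomp Require Import all_boot all_order all_algebra fingroup perm.
From mathcomp Require Import all_classical all_reals all_analysis.

(** Let [sigma_k : G_c -> Sym(T_c)] be the sofic approximations of the vertex
groups, where [T_c] depends on [k].  The aim is a finite set [Q] on which all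
the groups [Sym(T_c)] act by exact homomorphisms, those of adjacent colours
commuting, such that a nonempty word [x_1 ... x_m] whose colours are reduced has no
fixed point [q] along whose trajectory every letter really moves what it acts
on.  Composing with [sigma_k] then gives a sofic approximation of the graph
product: exact homomorphisms of the [Sym(T_c)] do not spoil the asymptotic
multiplicativity, and almost every trajectory is moved at every letter since
[sigma_k x] moves almost every point of [T_c] when [x != 1].

The set is [Q = Sym(V) * \prod_c T_c], where [V] is a finite set carrying
actions of one finite group [K], one action per colour, those of adjacent
colours commuting.  Fix injections [a : T_c -> K].  A permutation [s] of [T_c]
sends [(p, t)] to the point whose coordinate [t_c] is replaced by [s t_c] and
whose [p] is multiplied by the action in colour [c] of
[a(t_c)^-1 a(s t_c)] ([twist]).  These increments telescope, so this is a
homomorphism; an increment is nontrivial exactly when [s] moves [t_c].  As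
[Sym(V)] acts regularly on itself, a word fixes [(p, t)] only if the product
of its increments acts trivially on [V].

It remains to find [V] such that a product of nontrivial elements of [K], with
reduced colours and length at most [n], acts nontrivially ([heap]).  A point of
[V] is a colouring [w] of the positions [0, ..., n-1] with a label in [K] at
each position.  The action in colour [c] multiplies the label at the positions
[i] of colour [c] such that, among the positions whose colour is neither [c]
nor adjacent to [c], exactly those after [i] have a nontrivial label.  This
condition cannot be altered by the actions of [c] and of the colours adjacent
to [c], so that these are actions and commute as required.  If [w] is the
sequence of colours of a reduced word and all labels are [1] at the start, the
letters of the word, read from the right, write their values one after the
other at their own positions ([heap_eval_suffix]), and the final labels are
nontrivial.

On the side of groups, two words have the same value in the graph product if
and only if they are related by the moves of the free product and by swaps of
neighbouring letters of adjacent colours ([word_val_eq]), and each word is so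
related to a reduced one ([reduced_word]).  An element other than [1] is thus
the value of a nonempty reduced word, to which the construction of [V]
applies. *)

Set Implicit Arguments.
Unset Strict Implicit.
Unset Printing Implicit Defensive.

Import Order.TTheory GRing.Theory Num.Theory.
Import numFieldNormedType.Exports.

Local Open Scope classical_set_scope.
Local Open Scope group_scope.
Local Open Scope quotient_scope.

(** * Reduced sequences of colours *)
Section Colours.
Variables (C : eqType) (E : rel C).

Definition apart : rel C := fun c d => (c != d) && ~~ E c d.

(** Global form of reducedness: two letters of the same colour can never be
brought together by swaps, as a letter that commutes with neither lies in
between. *)
Definition well_separated (cs : seq C) : Prop :=
  forall i j c, i < j -> onth cs i = Some c -> onth cs j = Some c ->
  exists l d, [/\ i < l < j, onth cs l = Some d & apart c d].

(** A letter of colour [c] put in front of a word of colours [cs] can be moved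
by swaps next to a letter of colour [c]. *)
Fixpoint reachable (c : C) (cs : seq C) : bool :=
  if cs is d :: cs' then (d == c) || E c d && reachable c cs' else false.

Fixpoint reduced (cs : seq C) : bool :=
  if cs is c :: cs' then ~~ reachable c cs' && reduced cs' else true.

Lemma unreachable_blocked c cs j : ~~ reachable c cs -> onth cs j = Some c ->
  exists l d, [/\ l < j, onth cs l = Some d & apart c d].
Proof.
elim: cs j => [|d cs IHcs] [|j] //=.
  by move=> + [dc]; rewrite dc eqxx.
rewrite negb_or => /andP[dc]; have [Ecd /= nr|nE _ _] := boolP (E c d).
  by move=> /(IHcs _ nr)[l [e [lj le ce]]]; exists l.+1, e.
by exists 0%N, d; rewrite /apart eq_sym dc nE.
Qed.

Lemma reduced_well_separated cs : reduced cs -> well_separated cs.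
Proof.
elim: cs => [|d cs IHcs] /= => [_ [|i] [|j]//|/andP[nr red] [|i] [|j] c //=].
  move=> _ [dc]; rewrite -dc => /(unreachable_blocked nr)[l [e [lj le ce]]].
  by exists l.+1, e.
rewrite ltnS => ij ic jc; have [l [e [ilj le ce]]] := IHcs red i j c ij ic jc.
by exists l.+1, e.
Qed.

End Colours.

(** * A finite set on which reduced words act nontrivially *)
Section Heap.
Variables (C : finType) (E : rel C) (K : finGroupType) (n : nat).
Hypotheses (Esym : symmetric E) (Eirr : irreflexive E).

(** A colouring of the positions by [v.1], where [None] marks an unused
position, and a label at each position in [v.2]. *)
Definition heap : finType :=
  ({ffun 'I_n -> option C} * {ffun 'I_n -> K})%type.

(** In the picture where a word is built from its last letter to its first,
position [i] is active when everything after it that does not commute with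
colour [c] is already written, and nothing before it is.  Positions of colour
[c] itself do not enter: this makes the set of active positions invariant
under the action of colour [c]. *)
Definition active (c : C) (v : heap) (i : 'I_n) : bool :=
  (v.1 i == Some c) &&
  [forall j, if v.1 j is Some d
             then apart E c d ==> ((v.2 j != 1) == (i < j)) else true].

Definition heap_mul (c : C) (k : K) (v : heap) : heap :=
  (v.1, [ffun i => if active c v i then v.2 i * k else v.2 i]).

(** The action of colour [d] changes labels of colour [d] only, and these are
not consulted for colour [c] unless [c] and [d] are apart. *)
Lemma active_heap_mul c d k v :
  ~~ apart E c d -> active c (heap_mul d k v) =1 active c v.
Proof.
move=> ncd i; rewrite /active /=; congr andb; apply: eq_forallb => j.
case vj: (v.1 j) => [e|//]; rewrite ffunE /active vj.
by have [[->]|] := Some e =P Some d; rewrite ?(negPf ncd).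
Qed.

Lemma apartcc c : ~~ apart E c c. Proof. by rewrite /apart eqxx. Qed.

Lemma heap_mulM c k k' v :
  heap_mul c k' (heap_mul c k v) = heap_mul c (k * k') v.
Proof.
congr pair; apply/ffunP => i; rewrite !ffunE active_heap_mul ?apartcc //.
by case: (active c v i); rewrite ?mulgA.
Qed.

Lemma heap_mul1 c v : heap_mul c 1 v = v.
Proof.
by case: v => w x; congr pair; apply/ffunP => i; rewrite !ffunE mulg1 if_same.
Qed.

(** Neither action changes the active positions of the other, and the two sets
of positions are disjoint since adjacent colours are distinct. *)
Lemma heap_mulC c d k k' v : E c d ->
  heap_mul c k (heap_mul d k' v) = heap_mul d k' (heap_mul c k v).
Proof.
move=> Ecd; have Edc : E d c by rewrite Esym.
congr pair; apply/ffunP => i; rewrite !ffunE.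
rewrite !active_heap_mul /apart ?Ecd ?Edc ?andbF //.
case ci: (active c v i); case di: (active d v i) => //.
move: ci di => /andP[/eqP ci _] /andP[/eqP]; rewrite ci => -[cd] _.
by rewrite cd Eirr in Ecd.
Qed.

Lemma heap_mulK c k : cancel (heap_mul c k) (heap_mul c k^-1).
Proof. by move=> v; rewrite heap_mulM mulgV heap_mul1. Qed.

Definition heap_perm c k : {perm heap} := perm (can_inj (heap_mulK c k)).

Lemma heap_permM c k k' : heap_perm c (k * k') = heap_perm c k * heap_perm c k'.
Proof. by apply/permP => v; rewrite permM !permE heap_mulM. Qed.

Lemma heap_perm1 c : heap_perm c 1 = 1.
Proof. by apply/permP => v; rewrite !permE heap_mul1. Qed.

Lemma heap_permC c d k k' : E c d ->
  heap_perm c k * heap_perm d k' = heap_perm d k' * heap_perm c k.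
Proof.
by move=> Ecd; apply/permP => v; rewrite !permM !permE heap_mulC // Esym.
Qed.

Definition heap_eval (L : seq (C * K)) (v : heap) : heap :=
  foldr (fun l v' => heap_perm l.1 l.2 v') v L.

(** The starting point adapted to a word: its own colours, and no label
written yet. *)
Definition heap_base (L : seq (C * K)) : heap :=
  ([ffun i : 'I_n => onth [seq l.1 | l <- L] i], [ffun=> 1]).

(** When the suffix [L2] has been applied, the labels from position [size L1]
on are those of [L].  The next letter finds exactly one active position, its
own: another position [i] of the same colour is separated from it by a
position [l] of a colour apart, which is already written if it lies after the
current one and not yet written otherwise, the opposite of what the activity
of [i] demands. *)
Lemma heap_eval_suffix (L1 L2 L : seq (C * K)) :
  L = L1 ++ L2 -> size L <= n -> well_separated E [seq l.1 | l <- L] ->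
  all (fun l => l.2 != 1) L ->
  heap_eval L2 (heap_base L) =
  ((heap_base L).1, [ffun i : 'I_n =>
     if i < size L1 then 1 else nth 1 [seq l.2 | l <- L] i]).
Proof.
elim: L2 L1 => [|[c k] L2 IH] L1 LE Ln sepL /allP Ln1.
  congr pair; apply/ffunP => i; rewrite !ffunE; case: ifP => // /negbT.
  by rewrite -leqNgt => ?; rewrite nth_default // size_map LE cats0.
rewrite /= (IH (rcons L1 (c, k))) //; last 2 first.
- by rewrite cat_rcons.
- exact/allP.
rewrite permE /heap_mul /=; congr pair; apply/ffunP => i; rewrite !ffunE.
rewrite size_rcons ltnS.
have mL : size L1 < size L by rewrite LE size_cat /= addnS ltnS leq_addr.
have cm : onth [seq l.1 | l <- L] (size L1) = Some c.
  by rewrite LE map_cat /= onth_cat size_map ltnn subnn.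
have km : nth 1 [seq l.2 | l <- L] (size L1) = k.
  by rewrite LE map_cat /= nth_cat size_map ltnn subnn.
(* Every position that carries a colour receives a nontrivial label. *)
have val1 l d : onth [seq l.1 | l <- L] l = Some d ->
    nth 1 [seq l.2 | l <- L] l != 1.
  case: (ltnP l (size L)) => [lL _|lL]; last first.
    by rewrite onth_default // size_map.
  by rewrite (nth_map (c, k)) //; apply/Ln1/mem_nth.
set v := (v in active _ v _); have -> : active c v i = (val i == size L1).
  apply/idP/eqP => [/andP[]|im].
    rewrite /v /= ffunE => /eqP ic /forallP av.
    case: (ltngtP i (size L1)) => // [im|mi].
      have [l [d [/andP[il lm] ld cd]]] := sepL _ _ _ im ic cm.
      have ln : l < n by apply: leq_trans Ln; apply: ltn_trans lm mL.
      have := av (Ordinal ln); rewrite !ffunE /= ld cd /= ltnS.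
      by rewrite (ltnW lm) eqxx il.
    have [l [d [/andP[ml li] ld cd]]] := sepL _ _ _ mi cm ic.
    have ln : l < n by apply: ltn_trans li (ltn_ord i).
    have := av (Ordinal ln); rewrite !ffunE /= ld cd /= ltnS.
    by rewrite leqNgt ml /= (val1 _ _ ld) ltnNge (ltnW li).
  rewrite /active /= ffunE im cm eqxx; apply/forallP => j; rewrite !ffunE.
  case jd: (onth _ j) => [d|//]; apply/implyP => _; rewrite ltnS.
  by case: leqP => _; rewrite ?eqxx // (val1 _ _ jd).
case: (ltngtP i (size L1)) => // ->.
by rewrite km mul1g.
Qed.

Lemma heap_eval_neq (L : seq (C * K)) :
  size L <= n -> well_separated E [seq l.1 | l <- L] ->
  all (fun l => l.2 != 1) L -> L != [::] ->
  heap_eval L (heap_base L) != heap_base L.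
Proof.
move=> Ln sepL L1; rewrite (@heap_eval_suffix [::] L L) //.
case: L Ln L1 {sepL} => [//|[c k] L] /= Ln /andP[k1 _] _.
apply/eqP => -[/ffunP/(_ (Ordinal (leq_ltn_trans (leq0n _) Ln)))].
by rewrite !ffunE /= => k1'; rewrite k1' eqxx in k1.
Qed.

End Heap.

(** * Turning permutations of the coordinates into permutations of one set *)
Section SetCoord.
Variables (C : finType) (T : C -> finType).
Implicit Types t : {dffun forall c, T c}.

Definition set_coord t (c : C) (y : T c) : {dffun forall c, T c} :=
  finfun (eqtype.dfwith t y).

Lemma set_coord_in t c (y : T c) : set_coord t y c = y.
Proof. by rewrite ffunE dfwith_in. Qed.

Lemma set_coord_out t c d (y : T c) : c != d -> set_coord t y d = t d.
Proof. by move=> cd; rewrite ffunE dfwith_out. Qed.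

Lemma set_coordK t c (y : T c) : set_coord (set_coord t y) (t c) = t.
Proof.
apply/ffunP => d; have [cd|cd] := eqVneq c d.
  by case: d / cd; rewrite set_coord_in.
by rewrite !set_coord_out.
Qed.

Lemma set_coord_id t c : set_coord t (t c) = t.
Proof.
apply/ffunP => d; have [cd|cd] := eqVneq c d.
  by case: d / cd; rewrite set_coord_in.
by rewrite !set_coord_out.
Qed.

Lemma set_coord_set t c (y z : T c) :
  set_coord (set_coord t y) z = set_coord t z.
Proof.
apply/ffunP => d; have [cd|cd] := eqVneq c d.
  by case: d / cd; rewrite !set_coord_in.
by rewrite !set_coord_out.
Qed.

Lemma set_coordC t c d (y : T c) (z : T d) : c != d ->
  set_coord (set_coord t y) z = set_coord (set_coord t z) y.
Proof.
move=> cd; apply/ffunP => e; have [ce|ce] := eqVneq c e.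
  by case: e / ce; rewrite set_coord_in set_coord_out 1?eq_sym // set_coord_in.
rewrite (set_coord_out _ _ ce); have [de|de] := eqVneq d e.
  by case: e / de ce => ce; rewrite !set_coord_in.
by rewrite !set_coord_out.
Qed.

End SetCoord.

Section Torsor.
Variables (C : finType) (E : rel C).
Hypotheses (Esym : symmetric E) (Eirr : irreflexive E).
Variables (K : finGroupType) (n : nat) (T : C -> finType).
Variables (a : forall c, T c -> K).
Hypothesis a_inj : forall c, injective (@a c).

(** The first component is the group [Sym(V)] seen as a set: its right
multiplications have no fixed points. *)
Definition torsor : finType :=
  ({perm heap C K n} * {dffun forall c, T c})%type.

Definition twist c (s : {perm T c}) (q : torsor) : torsor :=
  (q.1 * heap_perm E n c ((a (q.2 c))^-1 * a (s (q.2 c))),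
   set_coord q.2 (s (q.2 c))).

(** The increments telescope:
[(a x)^-1 (a y) * ((a y)^-1 (a z)) = (a x)^-1 (a z)]. *)
Lemma twistM c (s s' : {perm T c}) q : twist s' (twist s q) = twist (s * s') q.
Proof.
rewrite /twist /= set_coord_in set_coord_set permM; congr pair.
by rewrite -mulgA -heap_permM mulgA mulgK.
Qed.

Lemma twist1 c q : twist (1 : {perm T c}) q = q.
Proof.
by case: q => p t; rewrite /twist /= perm1 mulVg heap_perm1 mulg1 set_coord_id.
Qed.

Lemma twistC c d (s : {perm T c}) (s' : {perm T d}) q :
  E c d -> twist s (twist s' q) = twist s' (twist s q).
Proof.
move=> Ecd; have cd : c != d by apply: contraTneq Ecd => ->; rewrite Eirr.
rewrite /twist /= !set_coord_out // 1?eq_sym // set_coordC 1?eq_sym //.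
by congr pair; rewrite -!mulgA heap_permC // Esym.
Qed.

Lemma twistK c (s : {perm T c}) : cancel (twist s) (twist s^-1).
Proof. by move=> q; rewrite twistM mulgV twist1. Qed.

Definition twist_perm c (s : {perm T c}) : {perm torsor} :=
  perm (can_inj (twistK s)).

Lemma twist_permM c (s s' : {perm T c}) :
  twist_perm (s * s') = twist_perm s * twist_perm s'.
Proof. by apply/permP => q; rewrite permM !permE twistM. Qed.

Lemma twist_perm1 c : twist_perm (1 : {perm T c}) = 1.
Proof. by apply/permP => q; rewrite !permE twist1. Qed.

Lemma twist_permC c d (s : {perm T c}) (s' : {perm T d}) :
  E c d -> twist_perm s * twist_perm s' = twist_perm s' * twist_perm s.
Proof.
by move=> Ecd; apply/permP => q; rewrite !permM !permE twistC // Esym.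
Qed.

Variables (G : C -> Type) (sigma : forall c, G c -> {perm T c}).

(** Letters act as maps from the last to the first, whereas products in
[{perm _}] compose from left to right; hence the reversed product. *)
Fixpoint word_perm (u : seq {c : C & G c}) : {perm torsor} :=
  if u is l :: u' then word_perm u' * twist_perm (sigma (tagged l)) else 1.

Lemma word_perm_cat u v : word_perm (u ++ v) = word_perm v * word_perm u.
Proof. by elim: u => [|l u IHu] /=; rewrite ?mulg1 // IHu mulgA. Qed.

Fixpoint moving (u : seq {c : C & G c}) (q : torsor) : bool :=
  if u is l :: u' then
    let x := (word_perm u' q).2 (tag l) in
    (sigma (tagged l) x != x) && moving u' q
  else true.

(** The coloured elements of [K] by which the first component of [q] is
successively multiplied when [u] acts on [q]. *)
Fixpoint increments (u : seq {c : C & G c}) (q : torsor) : seq (C * K) :=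
  if u is l :: u' then
    let x := (word_perm u' q).2 (tag l) in
    (tag l, (a x)^-1 * a (sigma (tagged l) x)) :: increments u' q
  else [::].

Lemma increments_colours u q :
  [seq l.1 | l <- increments u q] = [seq tag l | l <- u].
Proof. by elim: u => //= l u ->. Qed.

Lemma word_perm_increments u q v :
  (word_perm u q).1 v = heap_eval E (increments u q) (q.1 v).
Proof.
by elim: u => [|l u IHu] /=; rewrite ?perm1 // permM permE /= permM IHu.
Qed.

Lemma increments_moving u q :
  moving u q -> all (fun l => l.2 != 1) (increments u q).
Proof.
elim: u => //= l u IHu /andP[mv /IHu->]; rewrite andbT.
by rewrite -eq_mulVg1 eq_sym (inj_eq (@a_inj _)).
Qed.

(** The base heap of the increments is moved by their product.  Reading it as
the image under [q.1] of some heap [v], the first components of [q] and of its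
image differ at [v]. *)
Lemma moving_neq u q : 0 < size u <= n ->
  reduced E [seq tag l | l <- u] -> moving u q -> word_perm u q != q.
Proof.
move=> /andP[u0 un] red mv; set L := increments u q.
have sL : size L = size u.
  by rewrite -(size_map (fun l => l.1)) increments_colours size_map.
have : heap_eval E L (heap_base n L) != heap_base n L.
  apply: heap_eval_neq; rewrite ?sL ?increments_colours //.
  - exact: reduced_well_separated.
  - exact: increments_moving.
  - by rewrite -size_eq0 sL -lt0n.
apply: contra_neq => uq.
by have := word_perm_increments u q (q.1^-1 (heap_base n L)); rewrite uq permKV.
Qed.

End Torsor.

(** * Words in a graph product *)
Section GraphWords.
Variables (C : choiceType) (E : rel C) (G : C -> groupType).
Hypothesis Esym : symmetric E.
Let word := seq {c : C & G c}.
Implicit Types u v w : word.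

Inductive gp_rel : word -> word -> Prop :=
| gp_rel_fp u v : fp_rel u v -> gp_rel u v
| gp_rel_swap u v c d (x : G c) (y : G d) : E c d ->
    gp_rel (u ++ [:: fp_letter x, fp_letter y & v])
           (u ++ [:: fp_letter y, fp_letter x & v])
| gp_rel_sym u v : gp_rel u v -> gp_rel v u
| gp_rel_trans u v w : gp_rel u v -> gp_rel v w -> gp_rel u w.

Lemma gp_rel_refl u : gp_rel u u.
Proof. exact/gp_rel_fp/fp_rel_refl. Qed.

Lemma gp_rel_ctx s t u v : gp_rel u v -> gp_rel (s ++ u ++ t) (s ++ v ++ t).
Proof.
elim=> {u v} [u v uv|u v c d x y Ecd|u v _|u v w _ uv _ vw].
- by apply/gp_rel_fp/fp_rel_cat/fp_rel_cat => //; apply: fp_rel_refl.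
- by rewrite -!catA !catA -!(catA _ _ t); apply: gp_rel_swap.
- exact: gp_rel_sym.
- exact: gp_rel_trans uv vw.
Qed.

Lemma gp_rel_cat u u' v v' :
  gp_rel u u' -> gp_rel v v' -> gp_rel (u ++ v) (u' ++ v').
Proof.
move=> uu' vv'; apply: (@gp_rel_trans _ (u' ++ v)).
  exact: (gp_rel_ctx [::] v uu').
by have := gp_rel_ctx u' [::] vv'; rewrite !cats0.
Qed.

Lemma free_val_cat u v :
  \pi_(free_product G) (u ++ v) =
  \pi_(free_product G) u * \pi_(free_product G) v.
Proof. exact: pi_fp_mul. Qed.

Lemma free_val_inv u :
  \pi_(free_product G) (fp_word_inv u) = (\pi_(free_product G) u)^-1.
Proof. exact: pi_fp_inv. Qed.

Definition word_val u : graph_product E G :=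
  \pi_(quotient_group (normal_closure (graph_commutators E (G := G))))
    (\pi_(free_product G) u).

Lemma word_val_cat u v : word_val (u ++ v) = word_val u * word_val v.
Proof. by rewrite /word_val pi_fp_mul pi_quotient_mul. Qed.

Lemma word_val_nil : word_val [::] = 1.
Proof. by []. Qed.

Lemma word_val_surj g : exists u, word_val u = g.
Proof.
elim/quotW: g => z; elim/quotW: z => u; by exists u.
Qed.

Lemma gp_rel_val u v : gp_rel u v -> word_val u = word_val v.
Proof.
elim=> {u v} [u v uv|u v c d x y Ecd|u v _|u v w _ uv _ vw] //.
- by congr (\pi _); apply/eqmodP/asboolP.
- rewrite !word_val_cat; congr (_ * _).
  rewrite -(cat1s _ (_ :: v)) -(cat1s (fp_letter y) v).
  rewrite -(cat1s (fp_letter y) (_ :: v)) -(cat1s (fp_letter x) v).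
  rewrite !word_val_cat !mulgA; congr (_ * _).
  rewrite -!word_val_cat.
  apply/esym/eqmodP/asboolP => N [_]; apply; exists c, d, x, y; split=> //.
  by rewrite !free_val_cat /fp_in /commg /conjg invgM !mulgA.
- by rewrite uv.
Qed.

(** The elements of the free product represented by words related to the empty
word form a normal subgroup that contains the defining commutators, hence
their normal closure. *)
Lemma word_val_eq u v : word_val u = word_val v -> gp_rel u v.
Proof.
move=> /eqmodP/asboolP.
pose N : set (free_product G) :=
  [set z | exists2 w : word,
     z = \pi_(free_product G) w & gp_rel w [::]]%classic.
move=> /(_ N)[].
  split; last first.
    move=> _ [c [d [x [y [Ecd ->]]]]].
    exists (fp_word_inv [:: fp_letter x] ++ fp_word_inv [:: fp_letter y] ++
            [:: fp_letter x] ++ [:: fp_letter y]).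
      by rewrite !free_val_cat !free_val_inv.
    have Edc : E d c by rewrite Esym.
    apply: gp_rel_trans (gp_rel_swap [:: _] [:: _] _ _ Edc) _.
    apply: gp_rel_fp.
    exact: fp_rel_cat (fp_rel_mulV [:: fp_letter x])
                      (fp_rel_mulV [:: fp_letter y]).
  split.
  - by exists [::] => //; apply: gp_rel_refl.
  - move=> _ _ [w -> w1] [w' -> w'1]; exists (w ++ fp_word_inv w').
      by rewrite free_val_cat free_val_inv.
    apply: gp_rel_trans (gp_rel_fp (fp_rel_mulV w')).
    apply: gp_rel_trans (gp_rel_cat w1 (gp_rel_refl _)) _.
    have := gp_rel_cat (gp_rel_refl (fp_word_inv w')) (gp_rel_sym w'1).
    by rewrite cats0.
  - move=> _ z [w -> w1]; elim/quotW: z => s.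
    exists (fp_word_inv s ++ w ++ s).
      by rewrite !free_val_cat free_val_inv.
    apply: gp_rel_trans (gp_rel_fp (fp_rel_mulV s)).
    exact: (gp_rel_ctx _ _ w1).
move=> w uvw w1.
have /eqmodP/asboolP vuw : v = u ++ w %[mod free_product G].
  by rewrite free_val_cat -uvw mulVKg.
apply: gp_rel_sym; apply: gp_rel_trans (gp_rel_fp vuw) _.
by have := gp_rel_cat (gp_rel_refl u) w1; rewrite cats0.
Qed.

Definition nontrivial (l : {c : C & G c}) : bool := tagged l != 1.

(** The front letter is swapped down to the first letter of its own colour and
multiplied into it, so that the length drops by one. *)
Lemma reachable_merge u c (x : G c) : reachable E c [seq tag l | l <- u] ->
  exists2 v, size v = size u & gp_rel (fp_letter x :: u) v.
Proof.
elim: u => //= -[d y] u IHu /=; have [dc _|_ /=] := eqVneq d c.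
  case: c / dc x {IHu} => x; exists (fp_letter (x * y) :: u) => //.
  exact/gp_rel_fp/(fp_rel_mul [::]).
move=> /andP[Ecd /IHu[v sv xuv]]; exists (fp_letter y :: v); rewrite /= ?sv //.
apply: gp_rel_trans (gp_rel_swap [::] _ _ _ Ecd) _.
exact: (gp_rel_cat (gp_rel_refl [:: _])).
Qed.

(** A word that is not reduced can be shortened: either a letter is trivial or
two letters can be merged. *)
Lemma reduced_word u : exists v,
  [/\ gp_rel u v, reduced E [seq tag l | l <- v] & all nontrivial v].
Proof.
suff [v [uv _ rv nv]] : exists v, [/\ gp_rel u v, size v <= size u,
    reduced E [seq tag l | l <- v] & all nontrivial v] by exists v.
have [n] := ubnP (size u); elim: n u => // n IHn [|[c x] u] /=.
  by move=> _; exists [::]; split=> //; apply: gp_rel_refl.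
rewrite ltnS => un; have [v [uv vu rv nv]] := IHn u un.
have xuv : gp_rel (fp_letter x :: u) (fp_letter x :: v).
  exact: (gp_rel_cat (gp_rel_refl [:: _])).
have [x1|x1] := eqVneq x 1.
  exists v; split=> //; last exact: leqW.
  apply: gp_rel_trans xuv _; rewrite x1.
  exact/gp_rel_fp/(fp_rel_one [::]).
have [/(reachable_merge x)[w wv xvw]|nr] :=
  boolP (reachable E c [seq tag l | l <- v]).
  have [|w' [ww' w'w rw' nw']] := IHn w; first by rewrite wv (leq_ltn_trans vu).
  exists w'; split=> //; last by rewrite leqW // (leq_trans w'w) // wv.
  by apply: gp_rel_trans xuv _; apply: gp_rel_trans xvw _.
exists (fp_letter x :: v); split=> //=; first by rewrite nr.
by rewrite /nontrivial x1.
Qed.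

End GraphWords.

(** * Hamming distance on finite sets *)
Section Density.
Variable R : realType.
Local Open Scope ring_scope.

Definition density (T : finType) (A : {set T}) : R := #|A|%:R / #|T|%:R.

Definition hdist (T : finType) (s t : {perm T}) : R :=
  density [set x | s x != t x]%SET.

Lemma dHammE N (s t : 'S_N) : dHamm R s t = hdist s t.
Proof. by rewrite /hdist /density card_ord. Qed.

Lemma density_ge0 (T : finType) (A : {set T}) : 0 <= density A.
Proof. by rewrite divr_ge0. Qed.

Lemma density_le1 (T : finType) (A : {set T}) : (0 < #|T|)%N -> density A <= 1.
Proof. by move=> T0; rewrite ler_pdivrMr ?ltr0n // mul1r ler_nat max_card. Qed.

Lemma density_sub (T : finType) (A B : {set T}) :
  A \subset B -> density A <= density B.
Proof.
by move=> AB; rewrite ler_wpM2r ?invr_ge0 // ler_nat subset_leq_card.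
Qed.

Lemma densityU (T : finType) (A B : {set T}) :
  density (A :|: B) <= density A + density B.
Proof.
rewrite -mulrDl ler_wpM2r ?invr_ge0 // -natrD ler_nat.
by rewrite cardsU leq_subr.
Qed.

Lemma density_setC (T : finType) (A : {set T}) : (0 < #|T|)%N ->
  density (~: A) = 1 - density A.
Proof.
move=> T0; rewrite /density cardsCs finset.setCK natrB ?max_card // mulrBl.
by rewrite divff // pnatr_eq0 -lt0n.
Qed.

Lemma density_preim (T : finType) (p : {perm T}) (A : {set T}) :
  density (p @^-1: A) = density A.
Proof. by rewrite /density card_preimset //; exact: perm_inj. Qed.

Lemma hdist_ge0 (T : finType) (s t : {perm T}) : 0 <= hdist s t.
Proof. exact: density_ge0. Qed.

Lemma hdist_refl (T : finType) (s : {perm T}) : hdist s s = 0.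
Proof.
rewrite /hdist /density (_ : [set _ | _]%SET = finset.set0) ?cards0 ?mul0r //.
by apply/finset.setP => x; rewrite !inE eqxx.
Qed.

Lemma hdist_sym (T : finType) (s t : {perm T}) : hdist s t = hdist t s.
Proof. by congr density; apply/finset.setP => x; rewrite !inE eq_sym. Qed.

Lemma hdist_triangle (T : finType) (t s u : {perm T}) :
  hdist s u <= hdist s t + hdist t u.
Proof.
apply: le_trans (densityU _ _); apply: density_sub; apply/fintype.subsetP => x.
by rewrite !inE; case: (s x =P t x) => [->|].
Qed.

Lemma hdist_mulr (T : finType) (u s t : {perm T}) :
  hdist (s * u)%g (t * u)%g = hdist s t.
Proof.
by congr density; apply/finset.setP => x; rewrite !inE !permM (inj_eq perm_inj).
Qed.

Lemma hdist_mull (T : finType) (u s t : {perm T}) :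
  hdist (u * s)%g (u * t)%g = hdist s t.
Proof.
rewrite -[RHS](density_preim u); congr density.
by apply/finset.setP => x; rewrite !inE !permM.
Qed.

(** If [f] is a coordinate of [U] with values in [T] that can be changed at
will by a reversible update, then it is equidistributed: exchanging the
coordinate of [u] with an independent [y : T] injects [A * T] into
[B * U]. *)
Lemma density_prod (T U : finType) (A : {set U}) (f : U -> T) (B : {set T})
    (upd : U -> T -> U) :
  (forall u y, f (upd u y) = y) -> (forall u y, upd (upd u y) (f u) = u) ->
  A \subset f @^-1: B -> density A <= density B.
Proof.
move=> fupd updK AB.
have : (#|A| * #|T| <= #|B| * #|U|)%N.
  rewrite -!cardsT -!cardsX.
  have inj : injective (fun z : U * T => (f z.1, upd z.1 z.2)).
    move=> [u y] [u' y'] /= [fu uy]; congr pair.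
      by rewrite -(updK u y) uy fu updK.
    by rewrite -(fupd u y) uy fupd.
  rewrite -(card_imset _ inj); apply/subset_leq_card/fintype.subsetP => z.
  move=> /imsetP[[u y] + ->]; rewrite !inE !andbT /= => /(fintype.subsetP AB).
  by rewrite inE.
rewrite /density -(ler_nat R) !natrM => le.
have [T0|T0] := posnP #|T|.
  have -> : #|A| = 0%N.
    apply/eqP; rewrite cards_eq0; apply/eqP/finset.setP => u; rewrite inE.
    by have := max_card (pred1 (f u)); rewrite card1 T0.
  by rewrite mul0r divr_ge0.
have [U0|U0] := posnP #|U|; first by rewrite U0 invr0 mulr0 divr_ge0.
by rewrite ler_pdivrMr ?ltr0n // mulrAC ler_pdivlMr ?ltr0n.
Qed.

End Density.

(** * Soficity from permutations of arbitrary finite sets *)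
Section Copies.
Variables (T : finType) (m : nat).

(** The permutation [s] acting on [m.+1] disjoint copies of [T]: the distances
are those of [T], but the size can be made as large as needed. *)
Definition copies_fun (s : {perm T}) (j : 'I_#|{: T * 'I_m.+1}|) :=
  enum_rank (s (enum_val j).1, (enum_val j).2).

Lemma copies_funK s : cancel (copies_fun s) (copies_fun s^-1).
Proof.
move=> j; rewrite /copies_fun enum_rankK /= permK -surjective_pairing.
exact: enum_valK.
Qed.

Definition copies s : 'S_#|{: T * 'I_m.+1}| := perm (can_inj (copies_funK s)).

Lemma copiesM s t : copies (s * t) = copies s * copies t.
Proof.
by apply/permP => j; rewrite permM !permE /copies_fun enum_rankK permM.
Qed.

Lemma copies1 : copies 1 = 1.
Proof.
apply/permP => j; rewrite !permE /copies_fun perm1 -surjective_pairing.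
exact: enum_valK.
Qed.

Lemma hdist_copies (R : realType) s t :
  hdist R (copies s) (copies t) = hdist R s t.
Proof.
rewrite /hdist /density.
have -> : [set j | copies s j != copies t j]%SET =
    enum_val @^-1: finset.setX [set x | s x != t x]%SET [set: 'I_m.+1]%SET.
  apply/finset.setP => j; rewrite !inE andbT !permE.
  by rewrite (inj_eq enum_rank_inj) xpair_eqE eqxx andbT.
rewrite on_card_preimset; last exact/onW_bij/enum_val_bij.
rewrite cardsX cardsT card_ord card_prod card_ord !natrM invfM mulrACA.
by rewrite card_ord divff ?mulr1 // pnatr_eq0.
Qed.

End Copies.

(** Replacing the [k]-th set by [k.+1] copies of itself makes the sizes tend to
infinity and preserves the distances. *)
Lemma sofic_of_perms (R : realType) (X : groupType) (T : nat -> finType)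
    (sigma : forall k, X -> {perm T k}) :
  countable [set: X] ->
  (\forall k \near \oo, 0 < #|T k|) ->
  (forall g h : X, hdist R (sigma k h * sigma k g) (sigma k (g * h))
     @[k --> \oo] --> (0 : R)%R) ->
  (forall g : X, hdist R (sigma k g) 1 @[k --> \oo] -->
     (if g == 1%g then 0 else 1 : R)%R) ->
  sofic R X.
Proof.
move=> cX T0 mulT freeT; split=> //.
exists (fun k => #|{: T k * 'I_k.+1}|), (fun k g => copies k (sigma k g)).
split.
- apply/cvgnyPge => A; near=> k; rewrite card_prod card_ord.
  have kA : A <= k.+1 by rewrite ltnW // ltnS; near: k; exact: nbhs_infty_ge.
  have Tk : 0 < #|T k| by near: k.
  by rewrite (leq_trans kA) // leq_pmull.
- move=> g h; under eq_fun => k do rewrite dHammE -copiesM hdist_copies.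
  exact: mulT.
- move=> g; under eq_fun => k do rewrite dHammE -[1](copies1 _ k) hdist_copies.
  exact: freeT.
Unshelve. all: by end_near.
Qed.

(** * The approximations of a graph product *)
Lemma countable_graph_product (C : finType) (E : rel C) (G : C -> groupType) :
  (forall c, countable [set: G c]) ->
  countable [set: graph_product E G].
Proof.
move=> cG.
have num c : {f : G c -> nat | injective f}.
  apply/cid; have /countable_injP[f fI] := cG c; exists f => x y.
  by apply: fI; rewrite in_setT.
pose code (l : {c : C & G c}) := (tag l, sval (num (tag l)) (tagged l)).
have code_inj : injective code.
  move=> [c x] [d y] eq; have cd : c = d := congr1 fst eq.
  case: d / cd y eq => y /(congr1 snd) /= /(svalP (num c)) -> //.
have rep g := cid (word_val_surj (E := E) (G := G) g).
apply/countable_injP; exists (fun g => pickle (map code (sval (rep g)))).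
move=> g h _ _ /(pcan_inj pickleK) /(inj_map code_inj) eq.
by rewrite -(svalP (rep g)) eq (svalP (rep h)).
Qed.

Section TwistDistance.
Variables (R : realType) (C : finType) (E : rel C) (K : finGroupType) (n : nat).
Variables (T : C -> finType) (a : forall c, T c -> K).
Local Notation torsor := (torsor K n T).

Lemma density_coord c (B : {set T c}) :
  (density R [set q : torsor | q.2 c \in B]%SET <= density R B)%R.
Proof.
apply: (@density_prod _ _ _ _ (fun q : torsor => q.2 c) _
  (fun q y => (q.1, set_coord q.2 y))).
- by move=> q y; rewrite /= set_coord_in.
- by move=> [p t] y; rewrite /= set_coordK.
- by apply/fintype.subsetP => q; rewrite !inE.
Qed.

Lemma hdist_twist_perm c (s t : {perm T c}) :
  (hdist R (twist_perm E n a s) (twist_perm E n a t) <= hdist R s t)%R.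
Proof.
apply: le_trans (density_coord _); apply: density_sub.
apply/fintype.subsetP => q; rewrite !inE !permE /twist.
by apply: contra => /eqP->.
Qed.

End TwistDistance.

Section Approximation.
Variables (R : realType) (C : finType) (E : rel C).
Hypotheses (Esym : symmetric E) (Eirr : irreflexive E).
Variables (G : C -> groupType) (N : C -> nat -> nat).
Variable sigma : forall c k, G c -> 'S_(N c k).
Hypothesis N_infty : forall c, N c @ \oo --> \oo.
Hypothesis sigmaM : forall c (x y : G c),
  hdist R (sigma k y * sigma k x) (sigma k (x * y)) @[k --> \oo] -->
  (0 : R)%R.
Hypothesis sigma_free : forall c (x : G c),
  hdist R (sigma k x) 1 @[k --> \oo] --> (if x == 1%g then 0 else 1 : R)%R.

Definition points k c : finType := 'I_(N c k).

(** One group into which all the sets [points k c] embed.  The extra point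
[None] gives transpositions that depend injectively on their other point. *)
Definition anchor_group k : finGroupType := {perm option {c : C & points k c}}.
Definition anchor k c (x : points k c) : anchor_group k :=
  tperm None (Some (Tagged (points k) x)).

Lemma anchor_inj k c : injective (@anchor k c).
Proof.
move=> x y /(congr1 (fun p : {perm _} => p None)); rewrite !tpermL => -[].
by move/eqP; rewrite eq_Tagged => /eqP.
Qed.

(** The heaps used at stage [k] have [k] positions, so that every given word
fits in them from some stage on. *)
Definition approx k (u : seq {c : C & G c}) :
    {perm torsor (anchor_group k) k (points k)} :=
  word_perm E k (@anchor k) (fun c => @sigma c k) u.

Lemma cvg0_le (f g : nat -> R) : (forall k, 0 <= f k <= g k)%R ->
  g @ \oo --> (0 : R)%R -> f @ \oo --> (0 : R)%R.
Proof.
move=> fg g0; apply: (@squeeze_cvgr _ _ _ _ (fun=> 0%R) g) => //.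
  exact: nearW.
exact: cvg_cst.
Qed.

Lemma cvg0_triangle (T : nat -> finType) (s t u : forall k, {perm T k}) :
  hdist R (s k) (t k) @[k --> \oo] --> (0 : R)%R ->
  hdist R (t k) (u k) @[k --> \oo] --> (0 : R)%R ->
  hdist R (s k) (u k) @[k --> \oo] --> (0 : R)%R.
Proof.
move=> st tu.
apply: (@cvg0_le _ (fun k => hdist R (s k) (t k) + hdist R (t k) (u k))%R).
  by move=> k; rewrite hdist_ge0; apply: hdist_triangle.
by rewrite -[0%R]addr0; apply: cvgD.
Qed.

Lemma approx_cat k u v : approx k (u ++ v) = approx k v * approx k u.
Proof. exact: word_perm_cat. Qed.

(** A move of the free product costs at most the defect of one [sigma] at a
product of two letters or at the identity, because distances are invariant
under multiplication on both sides and do not grow under [twist_perm]. *)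
Lemma approx_fp_rel u v : fp_rel u v ->
  hdist R (approx k u) (approx k v) @[k --> \oo] --> (0 : R)%R.
Proof.
elim=> {u v} [u v c|u v c x y|u|u v _|u v w _ uv _ vw].
- have := @sigma_free c 1; rewrite eqxx; apply: cvg0_le => k.
  rewrite hdist_ge0 !approx_cat hdist_mulr /= -{2}(mulg1 (approx k v)).
  rewrite hdist_mull.
  by rewrite -(twist_perm1 E k (@anchor k) c); apply: hdist_twist_perm.
- have := @sigmaM c x y; apply: cvg0_le => k.
  rewrite hdist_ge0 !approx_cat hdist_mulr /= -mulgA hdist_mull -twist_permM.
  exact: hdist_twist_perm.
- by under eq_fun => k do rewrite hdist_refl; exact: cvg_cst.
- by under eq_fun => k do rewrite hdist_sym.
- exact: cvg0_triangle uv vw.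
Qed.

(** Swaps cost nothing: permutations of adjacent colours commute exactly. *)
Lemma approx_gp_rel u v : gp_rel E u v ->
  hdist R (approx k u) (approx k v) @[k --> \oo] --> (0 : R)%R.
Proof.
elim=> {u v} [u v|u v c d x y Ecd|u v _|u v w _ uv _ vw].
- exact: approx_fp_rel.
- under eq_fun => k.
    have -> : approx k (u ++ [:: fp_letter x, fp_letter y & v]) =
              approx k (u ++ [:: fp_letter y, fp_letter x & v]).
      rewrite !approx_cat /=; congr (_ * _); rewrite -!mulgA; congr (_ * _).
      by apply: twist_permC => //; rewrite Esym.
    rewrite hdist_refl; over.
  exact: cvg_cst.
- by under eq_fun => k do rewrite hdist_sym.
- exact: cvg0_triangle uv vw.
Qed.

Definition stuck k (u : seq {c : C & G c}) :=
  [set q : torsor (anchor_group k) k (points k) |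
    ~~ moving E (@anchor k) (fun c => @sigma c k) u q]%SET.

(** Since [approx k u] is a bijection and every coordinate is equidistributed,
the proportion of the trajectories that stop at a given letter [x] is at most
the proportion of fixed points of [sigma k x]. *)
Lemma stuck_cvg0 u : all (@nontrivial _ G) u ->
  density R (stuck k u) @[k --> \oo] --> (0 : R)%R.
Proof.
elim: u => [_|[c x] u IHu /= /andP[x1 /IHu cvgu]].
  under eq_fun => k.
    rewrite /density (_ : stuck k [::] = finset.set0); last first.
      by apply/finset.setP => q; rewrite !inE.
    rewrite cards0 mul0r; over.
  exact: cvg_cst.
have := @sigma_free c x; rewrite (negPf x1) => cvgx.
apply: (@squeeze_cvgr _ _ _ _ (fun=> 0%R)
  (fun k => 1 - hdist R (sigma k x) 1 + density R (stuck k u))%R); first last.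
- rewrite -[X in _ --> X]addr0 -{1}(subrr (1 : R)%R); apply: cvgD cvgu.
  by apply: cvgB cvgx; exact: cvg_cst.
- exact: cvg_cst.
near=> k.
have Nk : 0 < #|'I_(N c k)|.
  rewrite card_ord; near: k.
  by have := N_infty c => /cvgnyPge/(_ 1%N).
rewrite density_ge0 /=.
have -> : stuck k (Tagged G x :: u) =
    approx k u @^-1: [set q : torsor (anchor_group k) k (points k) |
      q.2 c \in [set z : points k c | sigma k x z == z]]%SET :|: stuck k u.
  by apply/finset.setP => q; rewrite !inE /= negb_and negbK.
apply: le_trans (densityU _ _ _) _; rewrite lerD2r density_preim.
apply: le_trans (density_coord R _ _ (T := points k) _) _.
rewrite -density_setC //; apply: density_sub; apply/fintype.subsetP => z.
by rewrite !inE perm1 negbK.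
Unshelve. all: by end_near.
Qed.

Lemma torsor_gt0_near :
  \forall k \near \oo, 0 < #|torsor (anchor_group k) k (points k)|.
Proof.
have : \forall k \near \oo, forall c, 0 < N c k.
  by apply: filter_forall => c; have := @N_infty c => /cvgnyPge/(_ 1%N).
apply: filterS => k Nk; apply/card_gt0P.
by exists (1, finfun (fun c => Ordinal (Nk c))).
Qed.

Lemma approx_free u : 0 < size u -> reduced E [seq tag l | l <- u] ->
  all (@nontrivial _ G) u ->
  hdist R (approx k u) 1 @[k --> \oo] --> (1 : R)%R.
Proof.
move=> u0 ru nu.
apply: (@squeeze_cvgr _ _ _ _
  (fun k => 1 - density R (stuck k u))%R (fun=> 1%R)).
- near=> k.
  have Q0 : 0 < #|torsor (anchor_group k) k (points k)|.
    by near: k; exact: torsor_gt0_near.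
  have uk : size u <= k by near: k; exact: nbhs_infty_ge.
  rewrite density_le1 // andbT -density_setC //; apply: density_sub.
  apply/fintype.subsetP => q; rewrite !inE negbK perm1.
  by apply: moving_neq; rewrite ?u0 //; apply: anchor_inj.
- by rewrite -[X in _ --> X]subr0; apply: cvgB (stuck_cvg0 nu); exact: cvg_cst.
- exact: cvg_cst.
Unshelve. all: by end_near.
Qed.

Lemma sofic_graph_product :
  (forall c, countable [set: G c]) -> sofic R (graph_product E G).
Proof.
move=> cG.
have rep g : {u | [/\ word_val E u = g, reduced E [seq tag l | l <- u]
                    & all (@nontrivial _ G) u]}.
  apply/cid; have [u <-] := word_val_surj g.
  have [v [uv rv nv]] := reduced_word E u.
  by exists v; split=> //; apply/esym/gp_rel_val.
apply: (@sofic_of_perms _ _ _ (fun k g => approx k (sval (rep g)))).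
- exact: countable_graph_product.
- exact: torsor_gt0_near.
- move=> g h; under eq_fun => k do rewrite -approx_cat.
  apply/approx_gp_rel/(word_val_eq Esym); rewrite word_val_cat.
  by have [-> _ _] := svalP (rep g); have [-> _ _] := svalP (rep h);
     have [-> _ _] := svalP (rep (g * h)).
- move=> g; case: (rep g) => u [/= ug ru nu]; have [g1|g1] := eqVneq g 1.
    have : gp_rel E u [::] by apply/(word_val_eq Esym); rewrite ug g1.
    exact: approx_gp_rel.
  apply: approx_free => //; case: u ug {ru nu} => // ug.
  by rewrite -ug word_val_nil eqxx in g1.
Qed.

End Approximation.

Theorem proposition1p2 (R : realType) (C : finType) (E : rel C)
    (Esym : symmetric E) (Eirr : irreflexive E) (G : C -> groupType)
    (Gsofic : forall c : C, sofic R (G c)) :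
  sofic R (graph_product E G).
Proof.
have model c : {N : nat -> nat & {sigma : forall k, G c -> 'S_(N k) |
    [/\ N @ \oo --> \oo,
        forall x y, hdist R (sigma k y * sigma k x) (sigma k (x * y))
          @[k --> \oo] --> (0 : R)%R
      & forall x, hdist R (sigma k x) 1 @[k --> \oo] -->
          (if x == 1%g then 0 else 1 : R)%R]}}.
  have [_ /cid[N /cid[sigma [N_infty sigmaM sigma_free]]]] := Gsofic c.
  exists N, sigma; split=> // [x y|x].
    by under eq_fun => k do rewrite -dHammE; exact: sigmaM.
  by under eq_fun => k do rewrite -dHammE; exact: sigma_free.
apply: (@sofic_graph_product R C E Esym Eirr G (fun c => projT1 (model c))
          (fun c => sval (projT2 (model c)))) => c.
- by case: (svalP (projT2 (model c))).
- by case: (svalP (projT2 (model c))).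
- by case: (svalP (projT2 (model c))).
- by have [] := Gsofic c.
Qed.
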